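(* Let $k\in\mathbb{Z}$ and $\lambda,\mu\in\mathbb{C}$. For every integer $n\ge0$, as polynomials in $x$, $$CP_{n}^{(k)}(x;\lambda,\mu)=\sum_{m=0}^{n}(-1)^{m}\binom{n}{m}CP_{n-m}^{(k)}(0;\lambda,\mu)\,x^{(m)}.$$
   Context: All generating functions are formal power series in $t$ over $\mathbb{C}$. For $k\in\mathbb{Z}$, $\mathrm{Lif}_k(t)=\sum_{n=0}^{\infty}\frac{t^{n}}{n!(n+1)^{k}}$. For $\lambda,\mu\in\mathbb{C}$, $(1+t)^{\lambda}=\sum_{j\ge0}\binom{\lambda}{j}t^j$ and $(1+(1+t)^{\lambda})^{-\mu}=2^{-\mu}\bigl(1+\frac12\sum_{j\ge 1}\binom{\lambda}{j}t^{j}\bigr)^{-\mu}$ (binomial series, $2^{-\mu}=e^{-\mu\log 2}$). The poly-Cauchy of the first kind and Peters mixed-type polynomials $CP_n^{(k)}(x;\lambda,\mu)$ are defined by $$(1+(1+t)^{\lambda})^{-\mu}\,\mathrm{Lif}_k(\log(1+t))\,(1+t)^{-x}=\sum_{n=0}^{\infty}CP_n^{(k)}(x;\lambda,\mu)\frac{t^n}{n!}.$$ The rising factorial is $x^{(m)}=x(x+1)\cdots(x+m-1)$, with $x^{(0)}=1$. *)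

(* Defs.v *)
From HB Require Import structures.
From mathcomp Require Import all_boot all_order all_algebra.
From mathcomp Require Import complex.
From mathcomp Require Import reals sequences exp trigo.

Set Implicit Arguments.
Unset Strict Implicit.
Unset Printing Implicit Defensive.

Import Order.TTheory GRing.Theory Num.Theory.

Local Open Scope ring_scope.
Local Open Scope complex_scope.

(* A formal power series in t is its coefficient sequence: f stands for
   \sum_n f n * t^n. *)
Definition fps (A : nzRingType) := nat -> A.

Section FormalPowerSeries.
Variable A : nzRingType.
Implicit Types f g : fps A.

Definition fps_one : fps A := fun n => (n == 0%N)%:R.

Definition fps_mul f g : fps A := fun n => \sum_(i < n.+1) f i * g (n - i)%N.

Definition fps_exp f (i : nat) : fps A := iter i (fps_mul f) fps_one.

Definition fps_scale (a : A) f : fps A := fun n => a * f n.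

(* Substitution f(g(t)), meaningful when g 0 = 0: then t^i divides g(t)^i, so
   the terms with i > n do not contribute to the coefficient of t^n. *)
Definition fps_comp f g : fps A :=
  fun n => \sum_(i < n.+1) f i * fps_exp g i n.

End FormalPowerSeries.

Definition fps_map (A B : nzRingType) (h : A -> B) (f : fps A) : fps B :=
  fun n => h (f n).

(* Used for A = C and A = C[x]; in both, j! is invertible. *)
Definition gbinom (A : comUnitRingType) (a : A) (j : nat) : A :=
  (\prod_(i < j) (a - i%:R)) / j`!%:R.

(* (1 + t)^a *)
Definition binomial_series (A : comUnitRingType) (a : A) : fps A := gbinom a.

(* log(1 + t) *)
Definition log1p_series (F : fieldType) : fps F :=
  fun n => if n is m.+1 then (-1) ^+ m / m.+1%:R else 0.

Definition Lif (F : fieldType) (k : int) : fps F :=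
  fun n => (n`!%:R * (n.+1%:R : F) ^ k)^-1.

Definition rising_factorial (A : nzRingType) (a : A) (m : nat) : A :=
  \prod_(i < m) (a + i%:R).

Section PolyCauchyPeters.
Variable R : realType.

Definition cexp (z : R[i]) : R[i] :=
  (expR (complex.Re z))%:C * (cos (complex.Im z) +i* sin (complex.Im z)).

(* 2^a, with the real logarithm of 2 *)
Definition two_cpow (a : R[i]) : R[i] := cexp (a * (ln (2 : R))%:C).

(* (1/2) \sum_(j >= 1) binom(lambda, j) t^j *)
Definition half_binomial_tail (lambda : R[i]) : fps R[i] :=
  fun j => if j == 0%N then 0 else 2^-1 * gbinom lambda j.

(* (1 + (1 + t)^lambda)^(- mu) *)
Definition peters_series (lambda mu : R[i]) : fps R[i] :=
  fps_scale (two_cpow (- mu))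
    (fps_comp (binomial_series (- mu)) (half_binomial_tail lambda)).

(* The generating function, with x the indeterminate 'X of {poly R[i]}. *)
Definition CP_gf (k : int) (lambda mu : R[i]) : fps {poly R[i]} :=
  fps_mul
    (fps_map polyC
       (fps_mul (peters_series lambda mu)
                (fps_comp (Lif R[i] k) (log1p_series R[i]))))
    (binomial_series (- 'X)).

Definition CP (k : int) (lambda mu : R[i]) (n : nat) : {poly R[i]} :=
  n`!%:R * CP_gf k lambda mu n.

End PolyCauchyPeters.

(* Main.v *)
(* The variable x enters the generating function only through
   (1 + t)^(-x) = \sum_m (-1)^m x^(m) t^m / m!, which is 1 at x = 0; so the
   other factors are the generating function of the CP_n(0), and the identity
   is the Cauchy product of the two series. *)
Require Import Defs.
From mathcomp Require Import all_boot all_order all_algebra.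
From mathcomp Require Import complex.
From mathcomp Require Import reals ring.
Local Open Scope ring_scope.

Import GRing.Theory Num.Theory.

(** Each factor [- 'X - i%:R] of the falling product is [- ('X + i%:R)], so the [j] signs collect
    into [(-1) ^+ j]. *)
Lemma binomial_seriesNX (F : numFieldType) (j : nat) :
  binomial_series (- 'X : {poly F}) j =
  ((-1) ^+ j / j`!%:R) *: rising_factorial 'X j.
Proof.
have fact_unit : (j`!%:R : F) \is a GRing.unit.
  by rewrite unitfE pnatr_eq0 -lt0n fact_gt0.
rewrite /binomial_series /gbinom /rising_factorial.
rewrite (eq_bigr (fun i : 'I_j => - ('X + (i%:R : {poly F})))); last first.
  by move=> i _; rewrite opprD.
(* [gbinom] inverts [j!] in [{poly F}]; as [j!] is a unit of [F], this inverse is the constant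
   polynomial of the inverse in [F]. *)
rewrite prodrN card_ord -polyC_natr -(rmorphV polyC fact_unit) -mul_polyC.
by rewrite polyCM rmorphXn rmorphN1 mulrAC.
Qed.

Lemma horner_rising_factorialX0 (A : comNzRingType) (j : nat) :
  (rising_factorial ('X : {poly A}) j).[0] = (j == 0%N)%:R.
Proof.
case: j => [|j]; first by rewrite /rising_factorial big_ord0 hornerC.
by rewrite /rising_factorial big_ord_recl /= addr0 hornerM hornerX mul0r.
Qed.

Lemma CP_gfE (R : realType) (k : int) (lambda mu : R[i]) (n : nat) :
  CP_gf k lambda mu n =
  \sum_(m < n.+1)
     ((-1) ^+ m / m`!%:R * (CP_gf k lambda mu (n - m)%N).[0])
       *: rising_factorial ('X : {poly R[i]}) m.
Proof.
pose c := fps_mul (peters_series lambda mu)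
                  (fps_comp (Lif R[i] k) (log1p_series R[i])).
have gfE p : CP_gf k lambda mu p =
    \sum_(m < p.+1) ((-1) ^+ m / m`!%:R * c (p - m)%N)
      *: rising_factorial ('X : {poly R[i]}) m.
  (* Reversing the sum makes [m] the index of the binomial factor rather than of [c]. *)
  rewrite /CP_gf {1}/fps_mul (reindex_inj rev_ord_inj) /=.
  apply: eq_bigr => m _.
  rewrite subSS subKn -1?ltnS // binomial_seriesNX /fps_map mul_polyC scalerA.
  by rewrite [in LHS]mulrC.
(* Every rising factorial with [m > 0] contains the factor ['X], so only the term [m = 0]
   survives. *)
have gf0 p : (CP_gf k lambda mu p).[0] = c p.
  rewrite gfE horner_sum big_ord_recl big1 => [|m _]; last first.
    by rewrite hornerZ horner_rising_factorialX0 mulr0.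
  rewrite hornerZ horner_rising_factorialX0 expr0 fact0 divr1 subn0.
  by rewrite mul1r mulr1 addr0.
by rewrite gfE; apply: eq_bigr => m _; rewrite gf0.
Qed.

Theorem theorem12 (R : realType) (k : int) (lambda mu : R[i]) (n : nat) :
  CP k lambda mu n =
  \sum_(m < n.+1)
     ((-1) ^+ m * 'C(n, m)%:R * (CP k lambda mu (n - m)%N).[0])
       *: rising_factorial ('X : {poly R[i]}) m.
Proof.
rewrite {1}/CP CP_gfE mulr_sumr; apply: eq_bigr => m _.
have le_mn : (m <= n)%N by rewrite -ltnS.
rewrite /CP -!polyC_natr !mul_polyC scalerA hornerZ; congr (_ *: _).
(* With [n! = 'C(n, m) * (m! * (n - m)!)], the [m!] cancels and [(n - m)!] is the normalization of
   [CP] at [n - m]. *)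
rewrite -(bin_fact le_mn) !natrM.
have fact_neq0 : (m`!%:R : R[i]) != 0 by rewrite pnatr_eq0 -lt0n fact_gt0.
by field.
Qed.
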